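(* Let $(X,d)$ be a b-metric space with coefficient $K_1\geqslant 1$, let $(Y,\rho)$ be a semimetric space, let $\eta\colon[0,\infty)\to[0,\infty)$ be a homeomorphism, and let $f\colon X\to Y$ be a surjective $\eta$-quasisymmetry. Suppose that there exists $K_2\geqslant 1$ such that for all real $t_1,t_2>0$ $$1\leqslant K_1\left(\frac{1}{t_1}+\frac{1}{t_2}\right)\quad\text{implies}\quad 1\leqslant K_2\left(\frac{1}{\eta(t_1)}+\frac{1}{\eta(t_2)}\right).$$ Then $\rho$ is a b-metric with coefficient $K_2$.
   Context: Write $\mathbb{R}^+=[0,\infty)$. A semimetric space is a set $X$ with a function $d\colon X\times X\to\mathbb{R}^+$ such that $d(x,y)=d(y,x)$ and $d(x,y)=0\Leftrightarrow x=y$ for all $x,y\in X$. A b-metric space with coefficient $K\geqslant 1$ is a semimetric space satisfying $d(x,y)\leqslant K(d(x,z)+d(z,y))$ for all $x,y,z\in X$; $d$ is then called a b-metric with coefficient $K$. An embedding is an injective continuous mapping whose inverse, defined on the image, is continuous; continuity of a map $g$ between semimetric spaces means that $d(x_n,x)\to0$ implies that the distance between $g(x_n)$ and $g(x)$ tends to $0$. For semimetric spaces $(X,d)$, $(Y,\rho)$ and a homeomorphism $\eta\colon\mathbb{R}^+\to\mathbb{R}^+$, an embedding $f\colon X\to Y$ is an $\eta$-quasisymmetry if $d(x,a)\leqslant t\,d(x,b)$ implies $\rho(f(x),f(a))\leqslant\eta(t)\,\rho(f(x),f(b))$ for all $a,b,x\in X$ and all $t\in\mathbb{R}^+$. *)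

(* Defs.v *)
From mathcomp Require Import all_boot all_order all_algebra.
From mathcomp Require Import all_classical all_reals all_analysis.

Set Implicit Arguments.
Unset Strict Implicit.
Unset Printing Implicit Defensive.

Import Order.TTheory GRing.Theory Num.Theory.
Import numFieldNormedType.Exports.

Local Open Scope classical_set_scope.
Local Open Scope ring_scope.

Definition semimetric (R : realType) (X : Type) (d : X -> X -> R) : Prop :=
  [/\ forall x y, 0 <= d x y,
      forall x y, d x y = d y x &
      forall x y, d x y = 0 <-> x = y].

Definition bmetric (R : realType) (X : Type) (K : R) (d : X -> X -> R) : Prop :=
  [/\ 1 <= K, semimetric d &
      forall x y z, d x y <= K * (d x z + d z y)].

(* Sequential continuity; a semimetric need not be continuous with respect to
   the convergence it defines, and its balls need not be open. *)
Definition semimetric_continuous (R : realType) (X Y : Type)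
    (d : X -> X -> R) (rho : Y -> Y -> R) (g : X -> Y) : Prop :=
  forall (u : nat -> X) (x : X),
    (fun n => d (u n) x) @ \oo --> (0 : R) ->
    (fun n => rho (g (u n)) (g x)) @ \oo --> (0 : R).

(* The inverse is a function on the subtype [range f] of [Y], which carries the
   restriction of [rho]; a total function [Y -> X] would exclude the embedding
   of an empty [X] into a nonempty [Y]. *)
Definition embedding (R : realType) (X Y : Type)
    (d : X -> X -> R) (rho : Y -> Y -> R) (f : X -> Y) : Prop :=
  [/\ injective f,
      semimetric_continuous d rho f &
      exists g : range f -> X,
        (forall y : range f, f (g y) = set_val y) /\
        semimetric_continuous
          (fun y z : range f => rho (set_val y) (set_val z)) d g].

(* A map [0, +oo[ -> [0, +oo[ is represented by a function on [R] of which only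
   the values on [0, +oo[ matter. *)
Definition homeomorphism_Rplus (R : realType) (eta : R -> R) : Prop :=
  [/\ set_bij `[0, +oo[ `[0, +oo[ eta,
      {within `[0, +oo[, continuous eta} &
      exists2 theta : R -> R,
        (forall t, 0 <= t -> theta (eta t) = t) &
        {within `[0, +oo[, continuous theta}].

Definition quasisymmetry (R : realType) (X Y : Type)
    (d : X -> X -> R) (rho : Y -> Y -> R) (eta : R -> R) (f : X -> Y) : Prop :=
  embedding d rho f /\
  forall (a b x : X) (t : R), 0 <= t ->
    d x a <= t * d x b -> rho (f x) (f a) <= eta t * rho (f x) (f b).

(* Main.v *)
Require Import Defs.
From mathcomp Require Import all_boot all_order all_algebra.
From mathcomp Require Import all_classical all_reals all_analysis.

Import Order.TTheory GRing.Theory Num.Theory.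
Import numFieldNormedType.Exports.

Local Open Scope classical_set_scope.
Local Open Scope ring_scope.

(** Rescale a triangle inequality by its left-hand side: for distinct points,
    [d x y <= K * (d x z + d z y)] says [1 <= K * (1 / t1 + 1 / t2)], where
    [t1 = d x y / d x z] and [t2 = d x y / d z y] are the ratios of the side
    [x y] to the two sides at [z].  An eta-quasisymmetry turns a ratio [t] of
    two sides with a common vertex into a ratio at most [eta t], here with
    vertex [x] for [t1] and vertex [y] for [t2]
    ([quasisymmetry_ratio]).  So the two sides of the image triangle that meet
    at the image of [z], measured in units of the third side, are at least
    [1 / eta t1] and [1 / eta t2], and the hypothesis relating [K1] and [K2]
    bounds the sum of these from below by [1 / K2].  Surjectivity makes every
    triangle of the target such an image; triangles with two equal vertices are
    settled by [1 <= K2]. *)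

Lemma semimetric_gt0 {R : realType} {X : Type} {d : X -> X -> R} {x y : X} :
  semimetric d -> x <> y -> 0 < d x y.
Proof.
move=> [d0 _ dE] xy; rewrite lt_neqAle d0 andbT eq_sym.
by apply/eqP => /dE.
Qed.

(** Taking [t] to be the exact ratio of the distances makes the premise of
    quasisymmetry an equality, so it always holds.  Positivity of [eta t] is
    read off the resulting inequality, whose left-hand side is positive. *)
Lemma quasisymmetry_ratio {R : realType} {X Y : Type}
    {d : X -> X -> R} {rho : Y -> Y -> R} {eta : R -> R} {f : X -> Y}
    {x a b : X} :
  semimetric d -> semimetric rho -> quasisymmetry d rho eta f ->
  x <> b -> f x <> f a ->
  0 < eta (d x a / d x b) /\
  rho (f x) (f a) * (1 / eta (d x a / d x b)) <= rho (f x) (f b).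
Proof.
move=> hd hrho [_ qs] xb fxa.
have dxb := semimetric_gt0 hd xb.
have rxa := semimetric_gt0 hrho fxa.
have [d0 _ _] := hd; have [rho0 _ _] := hrho.
have t0 : 0 <= d x a / d x b by rewrite divr_ge0.
have le_rho : rho (f x) (f a) <= eta (d x a / d x b) * rho (f x) (f b).
  by apply: qs => //; rewrite divfK // gt_eqF.
have eta0 : 0 < eta (d x a / d x b).
  rewrite ltNge; apply/negP => eta_le0.
  have := lt_le_trans rxa le_rho.
  by rewrite ltNge mulr_le0_ge0.
by split=> //; rewrite mul1r ler_pdivrMr // mulrC.
Qed.

Theorem theorem3p1 (R : realType) (X Y : Type)
    (d : X -> X -> R) (rho : Y -> Y -> R) (K1 : R)
    (eta : R -> R) (f : X -> Y)
    (hd : bmetric K1 d)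
    (hrho : semimetric rho)
    (heta : homeomorphism_Rplus eta)
    (hf : quasisymmetry d rho eta f)
    (fsurj : set_surj [set: X] [set: Y] f)
    (K2 : R) (hK2 : 1 <= K2)
    (hK : forall t1 t2 : R, 0 < t1 -> 0 < t2 ->
       1 <= K1 * (1 / t1 + 1 / t2) ->
       1 <= K2 * (1 / eta t1 + 1 / eta t2)) :
  bmetric K2 rho.
Proof.
have [_ hsd trid] := hd; have [d0 dC dE] := hsd; have [r0 rC rE] := hrho.
split=> // u v w.
have [x _ <-] := fsurj u I.
have [y _ <-] := fsurj v I.
have [z _ <-] := fsurj w I.
have rxx p : rho p p = 0 by apply/rE.
have [->|fxy] := pselect (f x = f y).
  by rewrite rxx mulr_ge0 ?addr_ge0 // (le_trans ler01).
have [->|fxz] := pselect (f x = f z).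
  by rewrite rxx add0r ler_peMl.
have [->|fyz] := pselect (f y = f z).
  by rewrite rxx addr0 ler_peMl.
have xy : x <> y by move=> e; apply: fxy; rewrite e.
have xz : x <> z by move=> e; apply: fxz; rewrite e.
have yz : y <> z by move=> e; apply: fyz; rewrite e.
have fyx : f y <> f x by move=> e; apply: fxy.
have [eta1 le1] := quasisymmetry_ratio hsd hrho hf xz fxy.
have [eta2 le2] := quasisymmetry_ratio hsd hrho hf yz fyx.
have dxy := semimetric_gt0 hsd xy.
have dxz := semimetric_gt0 hsd xz.
have dyz := semimetric_gt0 hsd yz.
rewrite (dC y x) in eta2 le2.
rewrite (rC (f y) (f x)) (rC (f y) (f z)) in le2.
set t1 := d x y / d x z in eta1 le1.
set t2 := d x y / d y z in eta2 le2.
have leK2 : 1 <= K2 * (1 / eta t1 + 1 / eta t2).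
  apply: hK; [by rewrite divr_gt0 | by rewrite divr_gt0 |].
  rewrite /t1 /t2 !mul1r !invf_div -mulrDl mulrA ler_pdivlMr // mul1r.
  by rewrite (dC y z) trid.
apply: (@le_trans _ _ (rho (f x) (f y) * (K2 * (1 / eta t1 + 1 / eta t2)))).
  by rewrite ler_peMr.
rewrite mulrCA ler_pM2l ?(lt_le_trans ltr01) //.
by rewrite mulrDr lerD.
Qed.
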